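(* Let $K \geq 1$ and let $A_1,A_2,A_3,A_4 \subseteq \mathbb{F}_2^n$ be non-empty sets such that $\omega(A_1,A_2,A_3,A_4) \geq \frac{1}{K}$. Then there exist a linear subspace $H \subseteq \mathbb{F}_2^n$ with $|H| \gg K^{-O(K)}|A_i|$ for each $i = 1,2,3,4$, and elements $x_1,x_2,x_3,x_4 \in \mathbb{F}_2^n$, such that \[ \prod_{i=1}^4 |A_i \cap (x_i + H)|^{1/4} \geq \frac{1}{2K}|H|.\]
   Context: $\mathbb{F}_2^n$ is the $n$-dimensional vector space over the two-element field. For non-empty $A_1,\dots,A_4 \subseteq \mathbb{F}_2^n$ the normalised energy is \[\omega(A_1,A_2,A_3,A_4) := \frac{|\{ (a_1,a_2,a_3,a_4) \in A_1 \times A_2 \times A_3 \times A_4 : a_1 + a_2 + a_3 + a_4 = 0 \}|}{(|A_1| |A_2| |A_3| |A_4|)^{3/4}}.\] The notation $|H| \gg K^{-O(K)}|A_i|$ means $|H| \geq c K^{-CK}|A_i|$ for some absolute constants $c,C>0$. *)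

(* Defs.v *)
From mathcomp Require Import all_boot all_order all_algebra.
From mathcomp Require Import reals exp.

Set Implicit Arguments.
Unset Strict Implicit.
Unset Printing Implicit Defensive.

Import Order.TTheory GRing.Theory Num.Theory.
Local Open Scope ring_scope.

Definition additive_quadruples (n : nat) (A : 'I_4 -> {set 'rV['F_2]_n}) :
    {set {ffun 'I_4 -> 'rV['F_2]_n}} :=
  [set a : {ffun 'I_4 -> 'rV['F_2]_n} | [forall i, a i \in A i] && (\sum_i a i == 0)].

Definition normalised_energy (R : realType) (n : nat)
    (A : 'I_4 -> {set 'rV['F_2]_n}) : R :=
  #|additive_quadruples A|%:R / (\prod_(i < 4) #|A i|%:R) `^ (3 / 4).

Definition vcoset (n : nat) (x : 'rV['F_2]_n) (H : {vspace 'rV['F_2]_n}) :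
    {set 'rV['F_2]_n} :=
  [set x + h | h in H].

(* Main.v *)
Require Import Defs.
From mathcomp Require Import all_boot all_order all_algebra.
From mathcomp Require Import reals exp.
From mathcomp Require Import ring lra.

(** Write N(B) for the number of additive quadruples of B = (B_1,...,B_4), put
    k = 1/K and g = k/22500, and choose B_i inside A_i maximising
    N(B) / prod_i |B_i|^(3/4 - g).  The small gain g in the exponent forces
    |B_i| >= k^(1/g)|A_i| = K^(-22500 K)|A_i|, because N(B) never
    exceeds prod_i |B_i|^(3/4), while N(B) >= k prod_i |B_i|^(3/4) still holds.

    Every frequency xi splits each B_i into two halves, and N(B) is the sum of
    the energies of the eight quadruples of halves of even parity.  Maximality
    turns this into an inequality on the densities of the halves, which forces
    the normalised Fourier coefficients p_i(xi) to be coherent: either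
    p_i(xi)^2 <= k/4 for all i, or p_i(xi)^2 >= 99/100 for all i.

    The frequencies of the second kind form a subgroup V.  Those of the first
    kind contribute at most a quarter of the energy, so that
    |V| prod_i |B_i|^(1/4) is at least (3/4) k 2^n, and averaging p_i^2 over V
    produces a coset of H = V^perp containing 99/100 of B_i. *)

Set Implicit Arguments.
Unset Strict Implicit.
Unset Printing Implicit Defensive.

Import Order.TTheory GRing.Theory Num.Theory.
Local Open Scope ring_scope.

(** * Inequalities for powers of the densities of the two halves of a set *)

Section SplitWeights.
Variable R : realType.
Implicit Types (x y t g w : R).

(** Weighted AM-GM: Young's inequality for [x ^ (1 - t)] and [1] with exponents [1 / (1 - t)] and
    [1 / t]. *)
Lemma powR_le_affine x t : 0 <= x -> 0 < t < 1 ->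
  x `^ (1 - t) <= (1 - t) * x + t.
Proof.
move=> x0 /andP[t0 t1]; have t1' : 0 < 1 - t by rewrite subr_gt0.
have := @conjugate_powR R (x `^ (1 - t)) 1 (1 - t)^-1 t^-1
  (powR_ge0 _ _) ler01.
rewrite !invr_gt0 !invrK subrK => /(_ t1' t0 erefl).
by rewrite -powRrM divff ?gt_eqF// powRr1// powR1 mulr1 mul1r [x * _]mulrC.
Qed.

Lemma powRX x t m : 0 <= x -> (x `^ t) ^+ m = x `^ (t * m%:R).
Proof. by move=> x0; rewrite powRrM powR_mulrn ?powR_ge0. Qed.

(** The exponent [3 - 4g] splits as [2 + (1 - 4g)], and the last factor is at most
    [x + 4g(1 - x)]. *)
Lemma powR_cube_le x g : 0 <= x -> 0 < g < 1 / 4 ->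
  (x `^ (3 / 4 - g)) ^+ 4 <= x ^+ 3 + 4 * g * x ^+ 2 * (1 - x).
Proof.
move=> x0 /andP[g0 g1]; rewrite powRX//.
have -> : (3 / 4 - g) * 4 = 2%:R + (1 - 4 * g) by lra.
rewrite powRD; last by apply/implyP => /eqP; lra.
rewrite powR_mulrn//.
have : x `^ (1 - 4 * g) <= (1 - 4 * g) * x + 4 * g.
  by apply: powR_le_affine => //; lra.
have := sqr_ge0 x; nra.
Qed.

(** The quantity bounded is [w ^ (3 - 4g)]. As [w <= 1], it lies between [w^3] and [w^2]; peeling
    off one factor [w] before the affine bound gives the finer estimate. *)
Lemma powR_sqrt_bounds w g : 0 <= w <= 1 / 2 -> 0 < g < 1 / 4 ->
  [/\ w ^+ 3 <= ((w ^+ 2) `^ (3 / 4 - g)) ^+ 2,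
      ((w ^+ 2) `^ (3 / 4 - g)) ^+ 2 <= w ^+ 3 + 2 * g * w &
      ((w ^+ 2) `^ (3 / 4 - g)) ^+ 2 <= w ^+ 2].
Proof.
move=> /andP[w0 w1] /andP[g0 g1]; rewrite powRX ?sqr_ge0//.
have [->|wn0] := eqVneq w 0.
  by rewrite !expr0n /= powR0 ?mulr0 ?addr0 ?lexx//; apply/eqP; lra.
have wp : 0 < w by rewrite lt_neqAle eq_sym wn0.
have w2p : 0 < w ^+ 2 by rewrite exprn_gt0.
have w21 : w ^+ 2 <= 1 by nra.
have w3 : w ^+ 3 = (w ^+ 2) `^ (3 / 2).
  rewrite -!(powR_mulrn _ (ltW wp)) -powRrM; congr (_ `^ _); lra.
split.
- by rewrite w3; apply: ger_powR; [rewrite w2p|lra].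
- have -> : (3 / 4 - g) * 2 = 2^-1 + (1 - 2 * g) by lra.
  rewrite powRD; last by apply/implyP => /eqP; lra.
  rewrite (powR12_sqrt (ltW w2p)) sqrtr_sqr (ger0_norm w0).
  have : (w ^+ 2) `^ (1 - 2 * g) <= (1 - 2 * g) * w ^+ 2 + 2 * g.
    by apply: powR_le_affine; [exact: ltW|lra].
  move=> /(ler_wpM2l w0)/le_trans; apply; rewrite -subr_ge0.
  have -> : w ^+ 3 + 2 * g * w - w * ((1 - 2 * g) * w ^+ 2 + 2 * g)
    = 2 * (g * w ^+ 3) by ring.
  by rewrite !mulr_ge0 ?exprn_ge0// ltW.
- by apply: ge1r_powR; [rewrite w2p|lra].
Qed.

(** The bounds reduce to [w = sqrt (al be)], where [y = 1 - 4w^2]. For [g = 0],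
    [a^4 + b^4 = 1 - 3w^2] and [(ab)^2 = w^3], so the squared norm is [1 - 3w^2(1 - 2w)], while
    [y(1 - y) <= 8w^2(1 - 2w)]. The gain [g] costs at most [4gw^2 + 12gw <= 7g]. *)
Lemma split_weight_bounds (al be g : R) (a := al `^ (3 / 4 - g))
    (b := be `^ (3 / 4 - g)) (y := (al - be) ^+ 2) :
  0 <= al -> 0 <= be -> al + be = 1 -> 0 < g < 1 / 4 ->
  [/\ (a ^+ 2 + b ^+ 2) ^+ 2 + (2 * a * b) ^+ 2
        <= 1 - 3 / 8 * (y * (1 - y)) + 7 * g,
      y <= 1 / 4 -> (a ^+ 2 + b ^+ 2) ^+ 2 <= 5 / 8 + 7 * g &
      (2 * a * b) ^+ 2 <= 1 - y].
Proof.
move=> al0 be0 ab1 g01; have be1 : be = 1 - al by lra.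
pose w := Num.sqrt (al * be).
have w2 : w ^+ 2 = al * be by rewrite sqr_sqrtr ?mulr_ge0.
have w0 : 0 <= w by rewrite sqrtr_ge0.
have yE : y = 1 - 4 * w ^+ 2 by rewrite w2 /y be1; ring.
have y0 : 0 <= y by rewrite sqr_ge0.
have w12 : w <= 1 / 2 by nra.
have wb : 0 <= w <= 1 / 2 by rewrite w0.
have [L U1 U2] := powR_sqrt_bounds wb g01.
have abE : (a * b) ^+ 2 = ((w ^+ 2) `^ (3 / 4 - g)) ^+ 2.
  by rewrite w2 powRM.
have a4 := powR_cube_le al0 g01; have b4 := powR_cube_le be0 g01.
rewrite -/a -/b -abE in a4 b4 L U1 U2.
have s4 : a ^+ 4 + b ^+ 4 <= 1 - 3 * w ^+ 2 + 4 * g * w ^+ 2.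
  apply: (le_trans (lerD a4 b4)); rewrite w2 be1 le_eqVlt; apply/orP; left.
  by apply/eqP; ring.
move/andP: g01 => [g0 g1].
have gw : g * w <= g / 2 by nra.
have gw2 : g * w ^+ 2 <= g / 4 by nra.
split.
- have -> : (a ^+ 2 + b ^+ 2) ^+ 2 + (2 * a * b) ^+ 2
     = a ^+ 4 + b ^+ 4 + 6 * (a * b) ^+ 2 by ring.
  have : y * (1 - y) <= 8 * (w ^+ 2 * (1 - 2 * w)).
    have -> : y * (1 - y) = 4 * w ^+ 2 * (1 - 2 * w) * (1 + 2 * w).
      by rewrite yE; ring.
    have : 0 <= w ^+ 2 * (1 - 2 * w) by rewrite mulr_ge0 ?sqr_ge0//; lra.
    nra.
  have -> : w ^+ 2 * (1 - 2 * w) = w ^+ 2 - 2 * w ^+ 3 by ring.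
  nra.
- move=> y14; have -> : (a ^+ 2 + b ^+ 2) ^+ 2
     = a ^+ 4 + b ^+ 4 + 2 * (a * b) ^+ 2 by ring.
  have w316 : 3 / 16 <= w ^+ 2 by lra.
  have : w ^+ 3 <= w ^+ 2 / 2 by rewrite exprS; nra.
  nra.
- have -> : (2 * a * b) ^+ 2 = 4 * (a * b) ^+ 2 by ring.
  by lra.
Qed.

(* Here y is the square of a normalised Fourier coefficient, a and b are the
   powers of the densities of the two halves, and h is the error due to the gain
   in the exponent.  The vectors v = (a^2 + b^2, 2ab) are almost in the unit
   disc; they are close to the circle only for y near 1, where v is near (1, 0),
   and for y near 0, where v is near the diagonal. *)
Definition split_weight_spec (h a b y : R) :=
  [/\ 0 <= a, 0 <= b, 0 <= y <= 1,
      (a ^+ 2 + b ^+ 2) ^+ 2 + (2 * a * b) ^+ 2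
        <= 1 - 3 / 8 * (y * (1 - y)) + h &
      (y <= 1 / 4 -> (a ^+ 2 + b ^+ 2) ^+ 2 <= 5 / 8 + h) /\
      (2 * a * b) ^+ 2 <= 1 - y].

Lemma cauchy_schwarz2 (P1 Q1 P2 Q2 m1 m2 : R) :
  P1 ^+ 2 + Q1 ^+ 2 <= m1 -> P2 ^+ 2 + Q2 ^+ 2 <= m2 ->
  (P1 * P2 + Q1 * Q2) ^+ 2 <= m1 * m2.
Proof.
move=> H1 H2; apply: (@le_trans _ _ ((P1 ^+ 2 + Q1 ^+ 2) * (P2 ^+ 2 + Q2 ^+ 2))).
  rewrite -subr_ge0; have -> : (P1 ^+ 2 + Q1 ^+ 2) * (P2 ^+ 2 + Q2 ^+ 2)
    - (P1 * P2 + Q1 * Q2) ^+ 2 = (P1 * Q2 - P2 * Q1) ^+ 2 by ring.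
  exact: sqr_ge0.
by apply: ler_pM => //; rewrite addr_ge0 ?sqr_ge0.
Qed.

(** On this range [y(1 - y) >= k / 200], a loss of at least [3k / 1600 >= 6h] against the error
    [h]. *)
Lemma gap_weight_le (k h a b y : R) : 0 < k <= 1 -> 100 * (32 * h) <= k ->
  split_weight_spec h a b y ->
  k / 4 < y < 99 / 100 ->
  (a ^+ 2 + b ^+ 2) ^+ 2 + (2 * a * b) ^+ 2 <= 1 - 4 * h.
Proof.
move=> /andP[k0 k1] hk [_ _ /andP[y0 y1] N _] /andP[ky y99].
suff kyy : k / 200 <= y * (1 - y) by apply: (le_trans N); lra.
clear N hk; have [y12|/ltW y12] := leP y (1 / 2).
  have : 0 <= y * (1 / 2 - y) by rewrite mulr_ge0 ?subr_ge0.
  by lra.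
have : 0 <= (y - 1 / 2) * (1 - y) by rewrite mulr_ge0 ?subr_ge0.
by lra.
Qed.

Lemma perturbed_product_lt1 (h : R) : 0 < h ->
  (1 - 4 * h) * (1 + h) * ((1 + h) * (1 + h)) < 1.
Proof.
move=> h0; rewrite -subr_gt0.
have -> : 1 - (1 - 4 * h) * (1 + h) * ((1 + h) * (1 + h))
  = h * (1 + h * (9 + 11 * h + 4 * h ^+ 2)) by ring.
by rewrite mulr_gt0// ltr_wpDr// mulr_ge0 ?ltW// !addr_gt0 ?mulr_gt0 ?exprn_gt0.
Qed.

(** Here [P1 <= 4/5] and [Q2 <= 1/10]: the two vectors point in different directions, so their inner
    product is below [91/100], which [f <= 101/100] cannot make up. *)
Lemma mixed_dot_product_lt1 (h y1 y2 P1 P2 Q1 Q2 f : R) :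
  0 < h -> h <= 1 / 100 -> 0 <= y1 -> 99 / 100 <= y2 ->
  0 <= P1 -> 0 <= P2 -> 0 <= Q1 -> 0 <= Q2 ->
  P1 ^+ 2 <= 5 / 8 + h -> Q1 ^+ 2 <= 1 - y1 ->
  P2 ^+ 2 + Q2 ^+ 2 <= 1 + h -> Q2 ^+ 2 <= 1 - y2 ->
  f ^+ 2 <= (1 + h) * (1 + h) -> ~ 1 <= (P1 * P2 + Q1 * Q2) * f.
Proof.
move=> h0 h1 y10 l2 P10 P20 Q10 Q20 P1s Q1s N2 Q2s fs.
have sq_le (u v : R) : 0 <= v -> u ^+ 2 <= v ^+ 2 -> u <= v.
  move=> v0 uv; have [u0|u0] := leP 0 u; last exact: (le_trans (ltW u0)).
  by rewrite -(@ler_pXn2r _ 2).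
have P1' : P1 <= 4 / 5 by apply: sq_le; [|apply: (le_trans P1s)]; lra.
have Q1' : Q1 <= 1 by apply: sq_le; [|apply: (le_trans Q1s)]; lra.
have Q2' : Q2 <= 1 / 10 by apply: sq_le; [|apply: (le_trans Q2s)]; lra.
have P2' : P2 <= 101 / 100.
  apply: sq_le; first lra.
  by have := sqr_ge0 Q2; clear -N2 h1; lra.
have f' : f <= 101 / 100.
  apply: (@le_trans _ _ (1 + h)); last lra.
  by apply: sq_le; [lra|rewrite expr2].
have PP := ler_pM P10 P20 P1' P2'; have QQ := ler_pM Q10 Q20 Q1' Q2'.
have e0 : 0 <= P1 * P2 + Q1 * Q2 by rewrite addr_ge0 ?mulr_ge0.
apply/negP; rewrite -ltNge.
apply: (le_lt_trans (ler_wpM2l e0 f')).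
by move: (P1 * P2) (Q1 * Q2) PP QQ => p q PP QQ; clear -PP QQ; lra.
Qed.

Section FourWeights.
Variables (k h a1 b1 y1 a2 b2 y2 a3 b3 y3 a4 b4 y4 : R).
Hypotheses (k01 : 0 < k <= 1) (h0 : 0 < h) (hk : 100 * (32 * h) <= k)
  (S1 : split_weight_spec h a1 b1 y1) (S2 : split_weight_spec h a2 b2 y2)
  (S3 : split_weight_spec h a3 b3 y3) (S4 : split_weight_spec h a4 b4 y4).

Let P (a b : R) := a ^+ 2 + b ^+ 2.
Let Q (a b : R) := 2 * a * b.

Let norm_le a b y : split_weight_spec h a b y ->
  P a b ^+ 2 + Q a b ^+ 2 <= 1 + h.
Proof.
case=> _ _ /andP[y0 y1'] N _; apply: (le_trans N).
by rewrite lerD2r gerBl !mulr_ge0 ?invr_ge0 ?subr_ge0.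
Qed.

(** A first vector in the gap has squared norm at most [1 - 4h], the others at most [1 + h]; by
    Cauchy-Schwarz the squared product would be at most [(1 - 4h)(1 + h)^3 < 1]. *)
Lemma no_gap : 1 <= (P a1 b1 * P a2 b2 + Q a1 b1 * Q a2 b2) *
   (P a3 b3 * P a4 b4 + Q a3 b3 * Q a4 b4) -> ~~ (k / 4 < y1 < 99 / 100).
Proof.
move=> H; apply/negP => /(gap_weight_le k01 hk S1) N1.
have E := cauchy_schwarz2 N1 (norm_le S2).
have F := cauchy_schwarz2 (norm_le S3) (norm_le S4).
move: H E F; set e := (_ + _); set f := (_ + _ : R); move=> H E F.
have : 1 <= e ^+ 2 * f ^+ 2 by rewrite -exprMn exprn_ege1.
case/andP: k01 => k0 k1.
move=> /le_trans/(_ (ler_pM (sqr_ge0 e) (sqr_ge0 f) E F)).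
by rewrite leNgt perturbed_product_lt1.
Qed.

Lemma no_mixed_pair : 1 <= (P a1 b1 * P a2 b2 + Q a1 b1 * Q a2 b2) *
   (P a3 b3 * P a4 b4 + Q a3 b3 * Q a4 b4) ->
  y1 <= 1 / 4 -> 99 / 100 <= y2 -> False.
Proof.
move=> H s1 l2; have h1 : h <= 1 / 100 by case/andP: k01 => _; move: hk; lra.
have F := cauchy_schwarz2 (norm_le S3) (norm_le S4); have N2 := norm_le S2.
case: S1 => a10 b10 /andP[y10 _] _ [/(_ s1) N1 Q1].
case: S2 => a20 b20 _ _ [_ Q2].
have P10 : 0 <= P a1 b1 by rewrite addr_ge0 ?sqr_ge0.
have P20 : 0 <= P a2 b2 by rewrite addr_ge0 ?sqr_ge0.
have Q10 : 0 <= Q a1 b1 by rewrite !mulr_ge0.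
have Q20 : 0 <= Q a2 b2 by rewrite !mulr_ge0.
exact: (mixed_dot_product_lt1 h0 h1 y10 l2 P10 P20 Q10 Q20 N1 Q1 N2 Q2 F H).
Qed.
End FourWeights.

(* Cauchy-Schwarz over the parity of the first two halves bounds the sum over
   even quadruples by the inner products (v_1, v_2) and (v_3, v_4). *)
Lemma parity_sum_sqr_le (a1 b1 a2 b2 a3 b3 a4 b4 : R) :
  ((a1 + b1) * ((a2 + b2) * ((a3 + b3) * (a4 + b4))) +
   (a1 - b1) * ((a2 - b2) * ((a3 - b3) * (a4 - b4)))) ^+ 2 <=
  4 * (((a1 ^+ 2 + b1 ^+ 2) * (a2 ^+ 2 + b2 ^+ 2) + (2 * a1 * b1) * (2 * a2 * b2)) *
       ((a3 ^+ 2 + b3 ^+ 2) * (a4 ^+ 2 + b4 ^+ 2) + (2 * a3 * b3) * (2 * a4 * b4))).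
Proof.
rewrite [X in X ^+ 2](_ : _ =
  ((a1 + b1) * (a2 + b2)) * ((a3 + b3) * (a4 + b4)) +
  ((a1 - b1) * (a2 - b2)) * ((a3 - b3) * (a4 - b4))); last by ring.
apply: (le_trans (cauchy_schwarz2 (lexx _) (lexx _))).
by rewrite le_eqVlt; apply/orP; left; apply/eqP; ring.
Qed.

(** Squaring the hypothesis and applying [parity_sum_sqr_le] makes the product of inner products at
    least 1. This product is symmetric in the first two weights, so [no_gap] and [no_mixed_pair]
    apply in both orders. *)
Lemma coherent_pair (k h a1 b1 y1 a2 b2 y2 a3 b3 y3 a4 b4 y4 : R) :
  0 < k <= 1 -> 0 < h -> 100 * (32 * h) <= k ->
  split_weight_spec h a1 b1 y1 -> split_weight_spec h a2 b2 y2 ->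
  split_weight_spec h a3 b3 y3 -> split_weight_spec h a4 b4 y4 ->
  2 <= (a1 + b1) * ((a2 + b2) * ((a3 + b3) * (a4 + b4))) +
       (a1 - b1) * ((a2 - b2) * ((a3 - b3) * (a4 - b4))) ->
  (y1 <= k / 4 /\ y2 <= k / 4) \/ (99 / 100 <= y1 /\ 99 / 100 <= y2).
Proof.
move=> k01 h0 hk S1 S2 S3 S4 H.
have {}H : 1 <= ((a1 ^+ 2 + b1 ^+ 2) * (a2 ^+ 2 + b2 ^+ 2) +
        (2 * a1 * b1) * (2 * a2 * b2)) *
       ((a3 ^+ 2 + b3 ^+ 2) * (a4 ^+ 2 + b4 ^+ 2) + (2 * a3 * b3) * (2 * a4 * b4)).
  have := parity_sum_sqr_le a1 b1 a2 b2 a3 b3 a4 b4.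
  move: H; set z := (_ + _ : R); move: (_ * _ : R) => e; nra.
have H' : 1 <= ((a2 ^+ 2 + b2 ^+ 2) * (a1 ^+ 2 + b1 ^+ 2) + (2 * a2 * b2) * (2 * a1 * b1)) *
       ((a3 ^+ 2 + b3 ^+ 2) * (a4 ^+ 2 + b4 ^+ 2) + (2 * a3 * b3) * (2 * a4 * b4)).
  by rewrite [X in (X + _) * _]mulrC [X in (_ + X) * _]mulrC.
have := no_gap k01 h0 hk S1 S2 S3 S4 H; have := no_gap k01 h0 hk S2 S1 S3 S4 H'.
have M := no_mixed_pair k01 h0 hk S1 S2 S3 S4 H.
have M' := no_mixed_pair k01 h0 hk S2 S1 S3 S4 H'.
case/andP: k01 => k0 k1.
rewrite !negb_and -!leNgt => /orP[s2|l2] /orP[s1|l1].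
- by left.
- by exfalso; apply: M' => //; lra.
- by exfalso; apply: M => //; lra.
- by right.
Qed.

Lemma forall_ord4 (P : 'I_4 -> Prop) :
  P 0 -> P 1 -> P 2%:R -> P 3%:R -> forall i, P i.
Proof.
move=> P0 P1 P2 P3 i.
by case: i => [[|[|[|[|//]]]] lti];
  [move: P0|move: P1|move: P2|move: P3]; congr P; apply: val_inj.
Qed.

Lemma prod_ord4 (F : 'I_4 -> R) :
  \prod_i F i = F 0 * (F 1 * (F 2%:R * F 3%:R)).
Proof.
rewrite !big_ord_recl big_ord0 mulr1.
by congr (F _ * (F _ * (F _ * F _))); apply: val_inj.
Qed.

(** The hypothesis is symmetric in the four weights, so index 0 can be paired with each other index;
    the side on which [y 0] lies then decides all four. *)
Lemma coherent_weights (k h : R) (a b y : 'I_4 -> R) :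
  0 < k <= 1 -> 0 < h -> 100 * (32 * h) <= k ->
  (forall i, split_weight_spec h (a i) (b i) (y i)) ->
  2 <= \prod_i (a i + b i) + \prod_i (a i - b i) ->
  (forall i, y i <= k / 4) \/ (forall i, 99 / 100 <= y i).
Proof.
move=> k01 h0 hk S; rewrite !prod_ord4 => H.
have C1 := coherent_pair k01 h0 hk (S 0) (S 1) (S 2%:R) (S 3%:R) H.
have C2 : (y 0 <= k / 4 /\ y 2%:R <= k / 4) \/
    (99 / 100 <= y 0 /\ 99 / 100 <= y 2%:R).
  apply: (coherent_pair k01 h0 hk (S 0) (S 2%:R) (S 1) (S 3%:R)).
  by apply: (le_trans H); rewrite le_eqVlt; apply/orP; left; apply/eqP; ring.
have C3 : (y 0 <= k / 4 /\ y 3%:R <= k / 4) \/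
    (99 / 100 <= y 0 /\ 99 / 100 <= y 3%:R).
  apply: (coherent_pair k01 h0 hk (S 0) (S 3%:R) (S 1) (S 2%:R)).
  by apply: (le_trans H); rewrite le_eqVlt; apply/orP; left; apply/eqP; ring.
have /andP[k0 k1] := k01.
case: C1 => -[y0 y1].
  left; apply: forall_ord4 => //.
    by case: C2 => -[] //; lra.
  by case: C3 => -[] //; lra.
right; apply: forall_ord4 => //.
  by case: C2 => -[] //; lra.
by case: C3 => -[] //; lra.
Qed.

Lemma split_weight_specP (g al be : R) :
  0 < g < 1 / 4 -> 0 <= al -> 0 <= be -> al + be = 1 ->
  split_weight_spec (7 * g) (al `^ (3 / 4 - g)) (be `^ (3 / 4 - g)) ((al - be) ^+ 2).
Proof.
move=> g01 al0 be0 ab1.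
have [B1 B2 B3] := split_weight_bounds al0 be0 ab1 g01.
by split; rewrite ?powR_ge0 ?sqr_ge0//=; nra.
Qed.

End SplitWeights.

(** * Characters, orthogonal complements and Fourier identities on [F_2^n] *)

Section Energy.
Variables (R : realType) (n : nat).
Local Notation T := 'rV['F_2]_n.
Implicit Types (x xi : T) (V : {set T}).

Definition dot xi x : 'F_2 := (x *m xi^T) 0 0.
Definition sgn (e : 'F_2) : R := (-1) ^+ e.
Definition fourier (A : {set T}) xi : R := \sum_(a in A) sgn (dot xi a).

Lemma F2_cases (e : 'F_2) : e = 0 \/ e = 1.
Proof. by case: e => [[|[|//]] ?]; [left|right]; apply: val_inj. Qed.

Lemma sgnD : {morph sgn : e f / e + f >-> e * f}.
Proof.
move=> e f; rewrite /sgn.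
by case: (F2_cases e) => ->; case: (F2_cases f) => ->;
  rewrite /= ?expr0 ?expr1 ?mul1r ?mulr1 ?mulrNN ?mulr1.
Qed.

Lemma sgn0 : sgn 0 = 1. Proof. by []. Qed.
Lemma sgn1 : sgn 1 = -1. Proof. by rewrite /sgn expr1. Qed.

Lemma sgn_norm e : `|sgn e| = 1.
Proof. by rewrite /sgn normr_sign. Qed.

Lemma dotDr xi : {morph dot xi : x y / x + y}.
Proof. by move=> x y; rewrite /dot mulmxDl mxE. Qed.

Lemma dotDl x : {morph dot^~ x : xi eta / xi + eta}.
Proof. by move=> xi eta; rewrite /dot raddfD mulmxDr mxE. Qed.

Lemma dot0r xi : dot xi 0 = 0. Proof. by rewrite /dot mul0mx mxE. Qed.

Lemma addrr_F2 x : x + x = 0.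
Proof. by apply/rowP => i; rewrite !mxE; case: (F2_cases (x 0 i)) => ->; apply: val_inj. Qed.

Lemma oppr_F2 x : - x = x.
Proof. by apply/eqP; rewrite eq_sym -addr_eq0 addrr_F2. Qed.

Lemma dot_eq0 x : (forall xi, dot xi x = 0) -> x = 0.
Proof.
move=> H; apply/rowP => i; have := H (delta_mx 0 i).
rewrite /dot !mxE (bigD1 i) //= big1 => [|j ji]; last first.
  by rewrite !mxE eqxx (negPf ji) /= mulr0.
by rewrite !mxE !eqxx /= mulr1 addr0.
Qed.

(** The annihilator of [V], built from kernels so that it is a linear subspace by type although [V]
    is only a set. *)
Definition orth V : {vspace T} :=
  (\bigcap_(xi in V) lker (linfun (mulmxr xi^T : T -> 'rV['F_2]_1)))%VS.

Lemma orthP V x : reflect (forall xi, xi \in V -> dot xi x = 0) (x \in orth V).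
Proof.
rewrite memvE; apply: (iffP subv_bigcapP) => H xi /H; rewrite -?memvE ?memv_ker ?lfunE /=.
  by move=> /eqP; rewrite /dot => ->; rewrite mxE.
move=> E; apply/eqP/matrixP => i j.
by rewrite !ord1 [RHS]mxE; exact: E.
Qed.

(** Over the two-element field this already says that [V] is a subspace. *)
Definition additively_closed V :=
  0 \in V /\ (forall xi eta, xi \in V -> eta \in V -> xi + eta \in V).

(** If some [eta] in [V] has [dot eta x = 1], translation by [eta] permutes [V] and flips every
    sign, so the sum is its own negative. *)
Lemma sum_sgn V x : additively_closed V ->
  \sum_(xi in V) sgn (dot xi x) = (x \in orth V)%:R * #|V|%:R.
Proof.
move=> [_ VD].
case: (pickP (fun eta => (eta \in V) && (dot eta x != 0))); last first.
  move=> none; have dot0 xi : xi \in V -> dot xi x = 0.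
    by move=> xiV; have := none xi; rewrite xiV => /negbFE/eqP.
  have -> : x \in orth V by apply/orthP.
  rewrite mul1r (eq_bigr (fun=> 1)) ?sumr_const// => xi /dot0 ->; exact: sgn0.
move=> eta /andP[etaV etax]; have -> : (x \in orth V) = false.
  by apply/negP => /orthP/(_ _ etaV)/eqP; rewrite (negPf etax).
rewrite mul0r; apply/eqP.
suff : \sum_(xi in V) sgn (dot xi x) + \sum_(xi in V) sgn (dot xi x) == 0.
  by rewrite -mulr2n mulrn_eq0.
rewrite addr_eq0.
have s1 : sgn (dot eta x) = -1.
  by move: etax; case: (F2_cases (dot eta x)) => -> //; rewrite ?eqxx// sgn1.
rewrite {1}(reindex_inj (addrI eta)) /= -sumrN.
apply/eqP; apply: eq_big => [xi|xi _].
  apply/idP/idP => [/(VD _ _ etaV)|]; last exact: VD.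
  by rewrite addrA addrr_F2 add0r.
by rewrite dotDl sgnD s1 mulN1r.
Qed.

Lemma setT_closed : additively_closed [set: T].
Proof. by split=> *; rewrite inE. Qed.

Lemma mem_orthT x : (x \in orth [set: T]) = (x == 0).
Proof.
apply/orthP/eqP => [H|-> xi _]; last exact: dot0r.
by apply: dot_eq0 => xi; apply: H; rewrite inE.
Qed.

(** Double counting of the signs over all [x] and all [xi] in [V]: summing over [xi] first gives the
    left side, while summing over [x] first leaves only [xi = 0]. *)
Lemma card_orth V : additively_closed V ->
  #|V|%:R * #|orth V|%:R = #|{: T}|%:R :> R.
Proof.
move=> Vc; have : \sum_(x : T) \sum_(xi in V) sgn (dot xi x) = #|V|%:R * #|orth V|%:R.
  under eq_bigr do rewrite sum_sgn//.
  rewrite -mulr_suml mulrC; congr (_ * _).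
  by rewrite -[RHS]sumr_const [RHS]big_mkcond; apply: eq_bigr => x _; case: (_ \in _).
move=> <-; rewrite exchange_big /= (bigD1 0) /=; last by case: Vc.
rewrite [X in _ + X]big1 ?addr0 => [|xi /andP[_ xi0]].
  rewrite (eq_bigr (fun=> 1)) ?sumr_const// => x _.
  by rewrite /dot trmx0 mulmx0 mxE sgn0.
have E x : dot xi x = dot x xi.
  by rewrite /dot -[x *m _]trmxK trmx_mul trmxK mxE.
under eq_bigr do rewrite E.
have := sum_sgn xi setT_closed; rewrite mem_orthT (negPf xi0) mul0r.
by apply: etrans; apply: eq_bigl => x; rewrite inE.
Qed.

(** Expanding the product and summing over all frequencies keeps exactly the quadruples of sum
    zero. *)
Lemma sum_fourier_prod (A : 'I_4 -> {set T}) :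
  \sum_xi \prod_i fourier (A i) xi
    = #|{: T}|%:R * #|additive_quadruples A|%:R.
Proof.
rewrite /fourier; under eq_bigr do rewrite bigA_distr_big_dep.
rewrite exchange_big /=.
have E (f : {ffun 'I_4 -> T}) :
    \sum_xi \prod_i sgn (dot xi (f i)) = (\sum_i f i == 0)%:R * #|{: T}|%:R.
  have := sum_sgn (\sum_i f i) setT_closed; rewrite mem_orthT cardsT => <-.
  apply: eq_big => [x|xi _]; first by rewrite inE.
  by rewrite (big_morph (dot xi) (dotDr xi) (dot0r xi)) (big_morph sgn sgnD sgn0).
under eq_bigr do rewrite E.
rewrite -mulr_suml mulrC; congr (_ * _).
rewrite -sumr_const [LHS]big_mkcond [RHS]big_mkcond; apply: eq_bigr => f _.
set b := (f \in _); have -> : b = [forall i, f i \in A i] by [].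
by rewrite inE; case: ifP => //= _; case: eqP.
Qed.

Lemma mem_vcoset x y (H : {vspace T}) : (y \in vcoset x H) = (x + y \in H).
Proof.
apply/imsetP/idP => [[h hH ->]|xyH]; first by rewrite addrA addrr_F2 add0r.
by exists (x + y); rewrite // addrA addrr_F2 add0r.
Qed.

(** The square is a sum over pairs [a, b] of [A]; summing over [V] keeps the pairs with [a + b] in
    [orth V], that is, in a common coset. *)
Lemma sum_fourier_sqr (A : {set T}) V : additively_closed V ->
  \sum_(xi in V) fourier A xi ^+ 2
    = #|V|%:R * \sum_(a in A) #|A :&: vcoset a (orth V)|%:R.
Proof.
move=> Vc.
have E xi : fourier A xi ^+ 2 = \sum_(a in A) \sum_(b in A) sgn (dot xi (a + b)).
  rewrite expr2 /fourier mulr_suml; apply: eq_bigr => a _.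
  by rewrite mulr_sumr; apply: eq_bigr => b _; rewrite dotDr sgnD.
under eq_bigr do rewrite E.
rewrite exchange_big mulr_sumr /=; apply: eq_bigr => a _.
rewrite exchange_big /=; under eq_bigr do rewrite sum_sgn//.
rewrite -mulr_suml mulrC; congr (_ * _).
rewrite -sumr_const [LHS]big_mkcond [RHS]big_mkcond; apply: eq_bigr => b _.
by rewrite inE mem_vcoset; case: (b \in A) => //=; case: (_ \in _).
Qed.

Lemma parseval (A : {set T}) : \sum_xi fourier A xi ^+ 2 = #|{: T}|%:R * #|A|%:R.
Proof.
have := sum_fourier_sqr A setT_closed.
rewrite cardsT [X in _ * X](_ : _ = #|A|%:R) => [<-|].
  by apply: eq_bigl => xi; rewrite inE.
rewrite -sumr_const; apply: eq_bigr => a aA.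
suff -> : A :&: vcoset a (orth setT) = [set a] by rewrite cards1.
apply/setP => b; rewrite !inE mem_vcoset mem_orthT addr_eq0 oppr_F2 eq_sym.
by case: eqVneq => [->|]; rewrite ?aA ?andbF.
Qed.

(** * Splitting the sets along a frequency, and the effect of maximality *)

Definition half_of (D : {set T}) xi (e : 'F_2) := [set a in D | dot xi a == e].

Lemma big_F2 (F : 'F_2 -> R) : \sum_e F e = F 0 + F 1.
Proof.
rewrite (bigD1 0) //= (bigD1 1) //= big1 ?addr0// => e /andP[e0 e1].
by case: (F2_cases e) => E; rewrite E ?eqxx// in e0 e1.
Qed.

Lemma half_sums (D : {set T}) xi :
  #|half_of D xi 0|%:R + #|half_of D xi 1|%:R = #|D|%:R :> R /\
  #|half_of D xi 0|%:R - #|half_of D xi 1|%:R = fourier D xi.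
Proof.
have E e : #|half_of D xi e|%:R = \sum_(a in D | dot xi a == e) 1 :> R.
  by rewrite -sumr_const; apply: eq_bigl => a; rewrite inE.
split.
  rewrite -[RHS]sumr_const (partition_big (dot xi) predT)//= big_F2.
  by rewrite !E.
rewrite /fourier (partition_big (dot xi) predT)//= big_F2 !E -sumrN.
by congr (_ + _); apply: eq_bigr => a /andP[_ /eqP ->]; rewrite ?sgn1.
Qed.

Lemma card_quadruples_split (A : 'I_4 -> {set T}) xi :
  #|additive_quadruples A| = (\sum_(e : {ffun 'I_4 -> 'F_2} | (\sum_i e i == 0)%R)
     #|additive_quadruples (fun i => half_of (A i) xi (e i))|)%N.
Proof.
rewrite -sum1_card (partition_big (fun a : {ffun 'I_4 -> T} => [ffun i => dot xi (a i)])
  (fun e : {ffun 'I_4 -> 'F_2} => \sum_i e i == 0)) /=.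
  apply: eq_bigr => e _; rewrite -sum1_card; apply: eq_bigl => a; rewrite !inE.
  apply/andP/andP => [[/andP[/forallP aA s0] /eqP <-]|[/forallP aA s0]].
    by split=> //; apply/forallP => i; rewrite inE aA ffunE eqxx.
  split; first by rewrite s0 andbT; apply/forallP => i; have := aA i; rewrite inE => /andP[].
  by apply/eqP/ffunP => i; rewrite ffunE; have := aA i; rewrite inE => /andP[_ /eqP].
move=> a; rewrite inE => /andP[_ /eqP s0]; under eq_bigr do rewrite ffunE.
by rewrite -(big_morph (dot xi) (dotDr xi) (dot0r xi)) s0 dot0r.
Qed.

(** Expanding both products weights each [e] by [1 + sgn (\sum_i e i)], which is 2 for even parity
    and 0 for odd. *)
Lemma parity_sum (c : 'I_4 -> 'F_2 -> R) :
  2 * \sum_(e : {ffun 'I_4 -> 'F_2} | \sum_i e i == 0) \prod_i c i (e i)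
   = \prod_i (c i 0 + c i 1) + \prod_i (c i 0 - c i 1).
Proof.
have E1 : \prod_i (c i 0 + c i 1) = \sum_(e : {ffun 'I_4 -> 'F_2}) \prod_i c i (e i).
  by rewrite -bigA_distr_bigA; apply: eq_bigr => i _; rewrite big_F2.
have E2 : \prod_i (c i 0 - c i 1) =
    \sum_(e : {ffun 'I_4 -> 'F_2}) sgn (\sum_i e i) * \prod_i c i (e i).
  rewrite (eq_bigr (fun i => \sum_e sgn e * c i e)); last first.
    by move=> i _; rewrite big_F2 sgn0 sgn1 mul1r mulN1r.
  rewrite bigA_distr_bigA; apply: eq_bigr => e _.
  by rewrite big_split (big_morph sgn sgnD sgn0).
rewrite E1 E2 -big_split big_mkcond mulr_sumr; apply: eq_bigr => e _ /=.
case: eqP => [->|/eqP s0]; first by rewrite sgn0 mul1r -mulr2n mulr_natl.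
have -> : \sum_i e i = 1 by case: (F2_cases (\sum_i e i)) s0 => -> //; rewrite eqxx.
by rewrite sgn1 mulN1r subrr mulr0.
Qed.

Definition nfourier (D : {set T}) xi : R := fourier D xi / #|D|%:R.

Section Extremal.
Variables (A : 'I_4 -> {set T}) (m th : R).
Hypothesis A0 : forall i, A i != set0.
Hypothesis N0 : (0 < #|additive_quadruples A|)%N.
Hypothesis mE : #|additive_quadruples A|%:R = m * \prod_i #|A i|%:R `^ th.
Hypothesis mmax : forall B : 'I_4 -> {set T}, (forall i, B i \subset A i) ->
  #|additive_quadruples B|%:R <= m * \prod_i #|B i|%:R `^ th.

Let cA0 i : 0 < #|A i|%:R :> R.
Proof. by rewrite ltr0n card_gt0. Qed.

Definition half_density i xi (e : 'F_2) : R := #|half_of (A i) xi e|%:R / #|A i|%:R.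

Lemma half_density_sums i xi :
  [/\ 0 <= half_density i xi 0, 0 <= half_density i xi 1,
      half_density i xi 0 + half_density i xi 1 = 1 &
      half_density i xi 0 - half_density i xi 1 = nfourier (A i) xi].
Proof.
have [E1 E2] := half_sums (A i) xi.
split; rewrite ?divr_ge0// -?mulrBl -?mulrDl ?E1 ?E2//.
by rewrite divff// gt_eqF.
Qed.

(** The energy of [A] is the sum over even quadruples of halves, each bounded through [mmax];
    dividing by [m * \prod_i #|A i|^th] leaves densities only. *)
Lemma extremal_parity_ge xi :
  2 <= \prod_i (half_density i xi 0 `^ th + half_density i xi 1 `^ th) +
       \prod_i (half_density i xi 0 `^ th - half_density i xi 1 `^ th).
Proof.
rewrite -(parity_sum (fun i e => half_density i xi e `^ th)).
rewrite -[X in X <= _]mulr1 ler_pM2l//.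
set Z := \prod_i #|A i|%:R `^ th.
have Z0 : 0 < Z by apply: prodr_gt0 => i _; rewrite powR_gt0.
have mZ : 0 < m * Z by rewrite -mE ltr0n.
rewrite -(ler_pM2l mZ) mulr1 -mE {1}(card_quadruples_split A xi) natr_sum mulr_sumr.
rewrite mE; apply: ler_sum => e _.
have -> : m * Z * \prod_i half_density i xi (e i) `^ th
    = m * \prod_i #|half_of (A i) xi (e i)|%:R `^ th.
  rewrite -mulrA -big_split /=; congr (_ * _); apply: eq_bigr => i _.
  by rewrite -powRM ?divr_ge0// mulrC divfK// gt_eqF.
by apply: mmax => i; apply/subsetP => a; rewrite inE => /andP[].
Qed.

End Extremal.

Lemma extremal_coherent (k : R) (A : 'I_4 -> {set T}) (m : R) (g := k / (150 * 150)) xi :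
  0 < k <= 1 -> (forall i, A i != set0) ->
  (0 < #|additive_quadruples A|)%N ->
  #|additive_quadruples A|%:R = m * \prod_i #|A i|%:R `^ (3 / 4 - g) ->
  (forall B : 'I_4 -> {set T}, (forall i, B i \subset A i) ->
    #|additive_quadruples B|%:R <= m * \prod_i #|B i|%:R `^ (3 / 4 - g)) ->
  (forall i, nfourier (A i) xi ^+ 2 <= k / 4) \/
  (forall i, 99 / 100 <= nfourier (A i) xi ^+ 2).
Proof.
move=> k01 A0 N0 mE mmax; have /andP[k0 k1] := k01.
have g0 : 0 < g by rewrite divr_gt0// mulr_gt0.
have gk : 150 * (150 * g) = k by rewrite /g; field.
have g01 : 0 < g < 1 / 4 by rewrite g0 /=; lra.
have := extremal_parity_ge A0 N0 mE mmax xi.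
have S i : split_weight_spec (7 * g) (half_density A i xi 0 `^ (3 / 4 - g))
    (half_density A i xi 1 `^ (3 / 4 - g)) (nfourier (A i) xi ^+ 2).
  have [d0 d1 s <-] := half_density_sums A0 i xi.
  exact: split_weight_specP.
have h0 : 0 < 7 * g by rewrite mulr_gt0.
(* This fixes the constant in [g]: [3200 * 7 = 22400] is below [150^2 = 22500]. *)
have hk : 100 * (32 * (7 * g)) <= k by lra.
exact: (coherent_weights k01 h0 hk S).
Qed.

(** * Energy bounds by Parseval, and the subspace given by a coherent spectrum *)

Lemma amgm4 (x : 'I_4 -> R) : \prod_i x i <= 1 / 4 * \sum_i x i ^+ 4.
Proof.
rewrite prod_ord4 (_ : \sum_i x i ^+ 4 =
  x 0 ^+ 4 + (x 1 ^+ 4 + (x 2%:R ^+ 4 + x 3%:R ^+ 4))); last first.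
  rewrite !big_ord_recl big_ord0 addr0.
  by congr (x _ ^+ 4 + (x _ ^+ 4 + (x _ ^+ 4 + x _ ^+ 4))); apply: val_inj.
move: (x 0) (x 1) (x 2%:R) (x 3%:R) => a b c d.
rewrite -subr_ge0 (_ : _ - _ = 1 / 4 * ((a ^+ 2 - b ^+ 2) ^+ 2
  + (c ^+ 2 - d ^+ 2) ^+ 2 + 2 * (a * b - c * d) ^+ 2)); last by field.
apply: mulr_ge0; first by rewrite divr_ge0.
by apply: addr_ge0; [apply: addr_ge0; apply: sqr_ge0|apply: mulr_ge0; rewrite ?sqr_ge0].
Qed.

Lemma powR_prod4 (x : 'I_4 -> R) (t : R) : (forall i, 0 <= x i) ->
  (\prod_i x i) `^ t = \prod_i x i `^ t.
Proof. by move=> x0; rewrite !prod_ord4 !powRM ?mulr_ge0. Qed.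

(** Signs satisfy [s + t <= 1 + st]. This is summed over [D], with [s] and [t] multiplied by the
    signs of the two coefficients; it makes the large spectrum closed under addition. *)
Lemma fourier_add (D : {set T}) xi eta :
  `|fourier D xi| + `|fourier D eta| <= #|D|%:R + `|fourier D (xi + eta)|.
Proof.
have key (e f : bool) : (-1) ^+ e * fourier D xi + (-1) ^+ f * fourier D eta
    <= #|D|%:R + `|fourier D (xi + eta)|.
  apply: (@le_trans _ _ (#|D|%:R + (-1) ^+ e * (-1) ^+ f * fourier D (xi + eta))).
    rewrite -sumr_const /fourier !mulr_sumr -!big_split; apply: ler_sum => a _ /=.
    rewrite dotDl sgnD.
    by case: (F2_cases (dot xi a)) => ->; case: (F2_cases (dot eta a)) => ->;
      rewrite ?sgn0 ?sgn1; case: e; case: f; rewrite ?expr0 ?expr1; lra.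
  rewrite lerD2l (le_trans (ler_norm _))// !normrM !normr_sign !mul1r//.
case: (ger0P (fourier D xi)) => _; case: (ger0P (fourier D eta)) => _.
- by have := key false false; rewrite /= !mul1r.
- by have := key false true; rewrite /= mul1r mulN1r.
- by have := key true false; rewrite /= mul1r mulN1r.
- by have := key true true; rewrite /= !mulN1r.
Qed.

Section NonEmpty.
Variable A : 'I_4 -> {set T}.
Hypothesis A0 : forall i, A i != set0.

Let pA := \prod_i #|A i|%:R : R.

Let cA0 i : 0 < #|A i|%:R :> R.
Proof. by rewrite ltr0n card_gt0. Qed.

Let pA0 : 0 < pA.
Proof. by apply: prodr_gt0 => i _. Qed.

Lemma fourierE i xi : fourier (A i) xi = #|A i|%:R * nfourier (A i) xi.
Proof. by rewrite /nfourier mulrC divfK// gt_eqF. Qed.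

Lemma nfourier_norm i xi : `|nfourier (A i) xi| <= 1.
Proof.
rewrite /nfourier normrM normfV [`|#|_|%:R|]ger0_norm// ler_pdivrMr// mul1r.
rewrite (le_trans (ler_norm_sum _ _ _))// -sumr_const ler_sum// => a _.
by rewrite sgn_norm.
Qed.

(** AM-GM for the factors [#|A i|^(1/4) |p_i|] gives fourth powers [#|A i| p_i^4 <= d #|A i| p_i^2],
    and by Parseval [#|A i| p_i^2] sums to [2^n]. The lemma serves with [d = 1] for all frequencies
    and with [d = k / 4] for the small ones. *)
Lemma sum_nfourier_le (d : R) (S : pred T) : 0 <= d ->
  (forall xi i, S xi -> nfourier (A i) xi ^+ 2 <= d) ->
  pA `^ (1 / 4) * \sum_(xi | S xi) \prod_i `|nfourier (A i) xi| <= d * #|{: T}|%:R.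
Proof.
move=> d0 Sd; rewrite mulr_sumr.
apply: (@le_trans _ _ (\sum_(xi | S xi) 1 / 4 *
    \sum_i d * (#|A i|%:R * nfourier (A i) xi ^+ 2))).
  apply: ler_sum => xi Sxi; rewrite powR_prod4// -big_split /=.
  apply: (le_trans (amgm4 _)); rewrite ler_wpM2l ?divr_ge0//.
  apply: ler_sum => i _; rewrite exprMn powRX// -mulrA mulVf ?pnatr_eq0// mulr1 powRr1//.
  rewrite [leRHS]mulrCA ler_wpM2l// -[4%N]/(2 * 2)%N exprM real_normK ?num_real//.
  by rewrite [leLHS]expr2 ler_wpM2r ?sqr_ge0// Sd.
apply: (@le_trans _ _ (\sum_xi 1 / 4 *
    \sum_i d * (#|A i|%:R * nfourier (A i) xi ^+ 2))).
  rewrite [leLHS]big_mkcond; apply: ler_sum => xi _; case: ifP => // _.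
  apply: mulr_ge0; first by rewrite divr_ge0.
  by apply: sumr_ge0 => i _; apply: mulr_ge0 => //; apply: mulr_ge0; rewrite ?sqr_ge0.
rewrite -mulr_sumr exchange_big /= (eq_bigr (fun=> d * #|{: T}|%:R)) => [|i _].
  by rewrite sumr_const card_ord -(mulr_natl (_ * _)); lra.
rewrite -[LHS]mulr_sumr -[X in _ * X]mulr_sumr; congr (_ * _).
apply: (mulfI (lt0r_neq0 (cA0 i))); rewrite mulrC [RHS]mulrC -parseval.
rewrite mulr_sumr mulr_suml; apply: eq_bigr => xi _; rewrite fourierE; ring.
Qed.

Let pA4 : pA = (pA `^ (1 / 4)) ^+ 4.
Proof. by rewrite powRX ?(ltW pA0)// -mulrA mulVf ?pnatr_eq0// mulr1 powRr1 ?(ltW pA0). Qed.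

Let pA3 : pA `^ (3 / 4) = (pA `^ (1 / 4)) ^+ 3.
Proof. by rewrite powRX ?ltW//; congr (_ `^ _); lra. Qed.

Let sum_prod_nfourier :
  pA * \sum_xi \prod_i nfourier (A i) xi = #|{: T}|%:R * #|additive_quadruples A|%:R.
Proof.
rewrite -sum_fourier_prod mulr_sumr; apply: eq_bigr => xi _.
by rewrite -big_split; apply: eq_bigr => i _; rewrite fourierE.
Qed.

Let cT0 : 0 < #|{: T}|%:R :> R.
Proof. by rewrite ltr0n; apply/card_gt0P; exists 0. Qed.

Lemma energy_le : #|additive_quadruples A|%:R <= pA `^ (3 / 4).
Proof.
have r0 : 0 < pA `^ (1 / 4) by rewrite powR_gt0.
have H : pA `^ (1 / 4) * \sum_xi \prod_i `|nfourier (A i) xi| <= #|{: T}|%:R.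
  rewrite -[leRHS]mul1r; apply: sum_nfourier_le => // xi i _.
  rewrite -[_ ^+ 2]real_normK ?num_real// exprn_ile1//.
  exact: nfourier_norm.
rewrite -(ler_pM2l cT0) -sum_prod_nfourier {1}pA4 pA3 exprS mulrC.
rewrite mulrA ler_wpM2r ?exprn_ge0 ?(ltW r0)//.
apply: le_trans H; rewrite mulrC ler_wpM2l ?(ltW r0)//.
by apply: ler_sum => xi _; rewrite -normr_prod ler_norm.
Qed.

Lemma coherent_structure (k : R) : 0 < k <= 1 ->
  (forall xi, (forall i, nfourier (A i) xi ^+ 2 <= k / 4) \/
     (forall i, 99 / 100 <= nfourier (A i) xi ^+ 2)) ->
  k * pA `^ (3 / 4) <= #|additive_quadruples A|%:R ->
  exists (H : {vspace T}) (x : 'I_4 -> T),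
    (forall i, 99 / 100 * #|A i|%:R <= #|A i :&: vcoset (x i) H|%:R :> R) /\
    3 / 4 * k * #|H|%:R <= pA `^ (1 / 4).
Proof.
move=> k01 coh NA; have /andP[k0 k1] := k01.
pose V := [set xi | [forall i, 99 / 100 <= nfourier (A i) xi ^+ 2]].
have VP xi : reflect (forall i, 99 / 100 <= nfourier (A i) xi ^+ 2) (xi \in V).
  by rewrite inE; apply: forallP.
have Vc : additively_closed V.
  split=> [|xi eta /VP xiV /VP etaV]; apply/VP.
    move=> i; rewrite /nfourier (_ : fourier (A i) 0 = #|A i|%:R).
      by rewrite divff ?gt_eqF// expr1n; lra.
    rewrite -sumr_const; apply: eq_bigr => a _.
    by rewrite /dot trmx0 mulmx0 mxE sgn0.
  (* One index suffices to refute the first alternative: [fourier_add] gives a coefficient of size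
     at least [98/100], while [small] allows at most [1/2]. *)
  case: (coh (xi + eta)) => // /(_ ord0) small; exfalso.
  have normE z : `|fourier (A ord0) z| = #|A ord0|%:R * `|nfourier (A ord0) z|.
    by rewrite fourierE normrM ger0_norm.
  have := fourier_add (A ord0) xi eta; rewrite !normE -mulrDr -[X in _ <= X + _]mulr1 -mulrDr.
  rewrite ler_pM2l//.
  have large (u : R) : 99 / 100 <= u ^+ 2 -> 99 / 100 <= `|u|.
    by rewrite -[u ^+ 2]real_normK ?num_real//; have := normr_ge0 u; nra.
  have := large _ (xiV ord0); have := large _ (etaV ord0).
  move: small; rewrite -[_ ^+ 2]real_normK ?num_real//.
  move: `|nfourier (A ord0) (xi + eta)| `|nfourier (A ord0) xi|
    `|nfourier (A ord0) eta| => u v w.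
  move=> us w99 v99 vw; have u12 : 1 / 2 < u by lra.
  by move: k1; nra.
have hV : 3 / 4 * k * #|orth V|%:R <= pA `^ (1 / 4).
  have V0 : 0 < #|V|%:R :> R.
    by rewrite ltr0n; apply/card_gt0P; exists 0; case: Vc.
  have r0 : 0 < pA `^ (1 / 4) by rewrite powR_gt0.
  have tail : pA `^ (1 / 4) * \sum_(xi | xi \notin V) \prod_i `|nfourier (A i) xi|
      <= k / 4 * #|{: T}|%:R.
    apply: sum_nfourier_le => [|xi i xiV]; first by rewrite divr_ge0// ltW.
    by case: (coh xi) => [->//|/VP]; rewrite (negPf xiV).
  have main : pA `^ (1 / 4) * \sum_xi \prod_i nfourier (A i) xi
      <= pA `^ (1 / 4) * #|V|%:R + k / 4 * #|{: T}|%:R.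
    rewrite (bigID (fun xi => xi \in V)) /= mulrDr lerD//.
      rewrite ler_wpM2l ?(ltW r0)// -sumr_const; apply: ler_sum => xi _.
      rewrite (le_trans (ler_norm _))// normr_prod.
      by apply: prodr_ile1 => i _; rewrite normr_ge0 nfourier_norm.
    apply: le_trans tail; rewrite ler_wpM2l ?(ltW r0)//.
    by apply: ler_sum => xi _; rewrite -normr_prod ler_norm.
  (* After multiplication by [#|V|] the left side is [3/4 * k * 2^n]: the total [k * 2^n] minus the
     largest possible tail. *)
  rewrite -(ler_pM2l V0) mulrCA card_orth//.
  have : k * #|{: T}|%:R <= pA `^ (1 / 4) * \sum_xi \prod_i nfourier (A i) xi.
    have r30 : 0 < (pA `^ (1 / 4)) ^+ 3 by rewrite exprn_gt0.
    rewrite -(ler_pM2l r30) [leRHS]mulrA -exprSr -pA4 sum_prod_nfourier.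
    by rewrite mulrA [leLHS]mulrC ler_pM2l// mulrC -pA3.
  move: (\sum_xi _) main => s main; lra.
have /fin_all_exists[x xP] i : exists a : T,
    99 / 100 * #|A i|%:R <= #|A i :&: vcoset a (orth V)|%:R :> R.
  (* If every coset held less than [99/100] of [A i], the average of the squared coefficients over
     [V] would be too small. *)
  apply/existsP; apply: contraT; rewrite negb_exists => /forallP small.
  have := sum_fourier_sqr (A i) Vc.
  have V0 : 0 < #|V|%:R :> R.
    by rewrite ltr0n; apply/card_gt0P; exists 0; case: Vc.
  have lo : #|V|%:R * (99 / 100 * #|A i|%:R ^+ 2) <= \sum_(xi in V) fourier (A i) xi ^+ 2.
    rewrite mulr_natl -sumr_const; apply: ler_sum => xi /VP/(_ i) large.
    by rewrite fourierE exprMn [leRHS]mulrC; apply: ler_wpM2r; rewrite ?sqr_ge0.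
  move=> E; move: lo; rewrite E ler_pM2l// leNgt => /negP[].
  (* A point of [A i] is needed for the summed inequality to be strict. *)
  have [a aA] := set0Pn _ (A0 i).
  rewrite expr2 mulrA mulr_natr -sumr_const.
  apply: ltr_sum => [|b _]; first by apply/hasP; exists a; rewrite ?mem_index_enum.
  by rewrite ltNge small.
by exists (orth V), x.
Qed.
End NonEmpty.

End Energy.

(** * Maximisers, their size, and the conclusion *)

Lemma exists_extremal (R : realType) (n : nat) (A : 'I_4 -> {set 'rV['F_2]_n})
    (th : R) : th != 0 ->
  exists (B : 'I_4 -> {set 'rV['F_2]_n}) (m : R),
  [/\ forall i, B i \subset A i,
      m = #|additive_quadruples B|%:R / \prod_i #|B i|%:R `^ th,
      #|additive_quadruples A|%:R / \prod_i #|A i|%:R `^ th <= m &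
      forall D : 'I_4 -> {set 'rV['F_2]_n}, (forall i, D i \subset A i) ->
        #|additive_quadruples D|%:R <= m * \prod_i #|D i|%:R `^ th].
Proof.
move=> th0.
(* Quotients with denominator 0 take the default value 0; their numerator vanishes too, so the bound
   cleared of denominators holds for empty sets as well. *)
have N0 (D : 'I_4 -> {set 'rV['F_2]_n}) : \prod_i #|D i|%:R `^ th = 0 :> R ->
    #|additive_quadruples D| = 0%N.
  move/eqP; rewrite prodf_seq_eq0 => /hasP[i _ /=].
  rewrite powR_eq0 pnatr_eq0 cards_eq0 => /andP[/eqP D0 _].
  by apply: eq_card0 => a; rewrite inE; apply/negP => /andP[/forallP/(_ i)];
    rewrite D0 inE.
pose Phi (f : {ffun 'I_4 -> {set 'rV['F_2]_n}}) : R :=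
  #|additive_quadruples f|%:R / \prod_i #|f i|%:R `^ th.
pose P (f : {ffun 'I_4 -> {set 'rV['F_2]_n}}) := [forall i, f i \subset A i].
have PA : P (finfun A) by apply/forallP => i; rewrite ffunE.
have ext (D D' : 'I_4 -> {set 'rV['F_2]_n}) : D =1 D' ->
    additive_quadruples D = additive_quadruples D' /\
    \prod_i #|D i|%:R `^ th = \prod_i #|D' i|%:R `^ th :> R.
  move=> E; split; last by apply: eq_bigr => i _; rewrite E.
  apply/setP => a; rewrite !inE; congr (_ && _).
  by apply: eq_forallb => i; rewrite E.
have PhiE D : Phi (finfun D) = #|additive_quadruples D|%:R / \prod_i #|D i|%:R `^ th.
  by rewrite /Phi; have [-> ->] := ext _ _ (ffunE D).
have [B /forallP BA Bmax] := @arg_maxP _ _ _ (finfun A) P Phi PA.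
exists B, (Phi B); split=> //.
  by rewrite -PhiE; exact: Bmax.
move=> D DA; have [Z|Z] := eqVneq (\prod_i #|D i|%:R `^ th : R) 0.
  by rewrite N0// Z mulr0.
rewrite -ler_pdivrMr; last by rewrite lt_neqAle eq_sym Z prodr_ge0// => i _; rewrite powR_ge0.
have PD : P (finfun D) by apply/forallP => i; rewrite ffunE.
by rewrite -PhiE; exact: Bmax.
Qed.

(** The factors other than [i] only decrease from [A] to [B] and can be cancelled, leaving
    [k * A i ^ g <= B i ^ g]; then the power [1 / g] is taken. *)
Lemma extremal_size (R : realType) (g k : R) (B A : 'I_4 -> R) :
  0 < g -> 0 < k -> (forall i, 0 < B i <= A i) ->
  k * (\prod_i A i) `^ g <= (\prod_i B i) `^ g ->
  forall i, k `^ g^-1 * A i <= B i.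
Proof.
move=> g0 k0 BA H i.
have B0 j : 0 < B j by case/andP: (BA j).
have A0 j : 0 < A j by case/andP: (BA j) => /lt_le_trans h /h.
have PA : 0 < \prod_(j | j != i) A j by apply: prodr_gt0.
have PB : 0 < \prod_(j | j != i) B j by apply: prodr_gt0.
have PAB : \prod_(j | j != i) B j <= \prod_(j | j != i) A j.
  by apply: ler_prod => j _; rewrite ltW//=; case/andP: (BA j).
have kA : k * A i `^ g <= B i `^ g.
  move: H; rewrite (bigD1 i)//= [X in _ <= X `^ _](bigD1 i)//=.
  rewrite !powRM ?(ltW (A0 i)) ?(ltW (B0 i)) ?(ltW PA) ?(ltW PB)// mulrA => H.
  have PA' : 0 < (\prod_(j | j != i) A j) `^ g by rewrite powR_gt0.
  rewrite -(ler_pM2r PA'); apply: (le_trans H).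
  rewrite ler_wpM2l ?powR_ge0// ge0_ler_powR ?nnegrE ?(ltW PA) ?(ltW PB) ?(ltW g0)//.
have kA0 : 0 <= k * A i `^ g by rewrite mulr_ge0 ?powR_ge0 ?(ltW k0).
have gV : 0 <= g^-1 by rewrite invr_ge0 ltW.
have := ge0_ler_powR gV _ _ kA; rewrite !nnegrE kA0 powR_ge0 => /(_ isT isT).
rewrite powRM ?powR_ge0 ?(ltW k0)// -!powRrM divff ?gt_eqF//.
by rewrite !powRr1 ?(ltW (A0 i)) ?(ltW (B0 i)).
Qed.

Theorem theorem1p10 (R : realType) :
  exists c C : R, [/\ 0 < c, 0 < C &
    forall (n : nat) (K : R) (A : 'I_4 -> {set 'rV['F_2]_n}),
      1 <= K ->
      (forall i, A i != set0) ->
      1 / K <= normalised_energy R A ->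
      exists (H : {vspace 'rV['F_2]_n}) (x : 'I_4 -> 'rV['F_2]_n),
        (forall i, c * K `^ (- (C * K)) * #|A i|%:R <= #|H|%:R) /\
        1 / (2 * K) * #|H|%:R
          <= \prod_(i < 4) #|A i :&: vcoset (x i) H|%:R `^ (1 / 4)].
Proof.
(* The first constant is the share of [B i] caught by its coset; the second comes from
   [1 / g = 150 * 150 * K]. *)
exists (99 / 100), (150 * 150); split; rewrite ?divr_gt0 ?mulr_gt0//.
move=> n K A K1 A0 energy.
have K0 : 0 < K := lt_le_trans ltr01 K1.
pose k := K^-1; pose g := k / (150 * 150).
have k01 : 0 < k <= 1 by rewrite invr_gt0 K0 invf_le1.
have /andP[k0 k1] := k01.
have g0 : 0 < g by rewrite divr_gt0// mulr_gt0.
have gk : 150 * (150 * g) = k by rewrite /g; field.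
have th0 : 3 / 4 - g != 0 by apply/eqP; lra.
have [B [m [BA mD mA mmax]]] := exists_extremal A th0.
have cA0 i : 0 < #|A i|%:R :> R by rewrite ltr0n card_gt0.
have pA0 : 0 < \prod_i #|A i|%:R :> R by apply: prodr_gt0.
have NA : k * (\prod_i #|A i|%:R) `^ (3 / 4) <= #|additive_quadruples A|%:R.
  by move: energy; rewrite /normalised_energy div1r ler_pdivlMr// powR_gt0.
have powB (x : R) : 0 < x -> x `^ (3 / 4 - g) = x `^ (3 / 4) / x `^ g.
  by move=> x0; rewrite powRB// (gt_eqF x0) implybT.
have mA' : k * (\prod_i #|A i|%:R) `^ g <= m.
  apply: le_trans mA; rewrite -powR_prod4// powB//.
  rewrite ler_pdivlMr ?divr_gt0 ?powR_gt0// -mulrA [X in _ * X]mulrC divfK//.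
  by rewrite gt_eqF ?powR_gt0.
have m0 : 0 < m by apply: lt_le_trans mA'; rewrite mulr_gt0// powR_gt0.
(* Positivity of [m] rules out a quotient that is 0 by default, so the maximiser consists of
   nonempty sets. *)
have /andP[NB0 ZB0] : (#|additive_quadruples B| != 0)%N &&
    (\prod_i #|B i|%:R `^ (3 / 4 - g) != 0 :> R).
  rewrite -(pnatr_eq0 R) -negb_or; apply: contraTN m0 => /orP[] /eqP Z.
    by rewrite mD Z mul0r ltxx.
  by rewrite mD Z invr0 mulr0 ltxx.
have mE : #|additive_quadruples B|%:R = m * \prod_i #|B i|%:R `^ (3 / 4 - g).
  by rewrite mD divfK.
have B0 i : B i != set0.
  apply: contra ZB0 => /eqP Bi.
  by rewrite (bigD1 i)//= Bi cards0 powR0// mul0r.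
rewrite -lt0n in NB0.
have cB0 i : 0 < #|B i|%:R :> R by rewrite ltr0n card_gt0.
have pB0 : 0 < \prod_i #|B i|%:R :> R by apply: prodr_gt0.
have coh xi : (forall i, nfourier R (B i) xi ^+ 2 <= k / 4) \/
    (forall i, 99 / 100 <= nfourier R (B i) xi ^+ 2).
  apply: extremal_coherent k01 B0 NB0 mE _ => D DB; apply: mmax => i.
  exact: subset_trans (DB i) (BA i).
have NBE : #|additive_quadruples B|%:R
    = m / (\prod_i #|B i|%:R) `^ g * (\prod_i #|B i|%:R) `^ (3 / 4).
  by rewrite mE -powR_prod4// powB// mulrA mulrAC.
have pB34 : 0 < (\prod_i #|B i|%:R : R) `^ (3 / 4) by rewrite powR_gt0.
have pBg : 0 < (\prod_i #|B i|%:R : R) `^ g by rewrite powR_gt0.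
(* Against the lower bound [mA'], this keeps the [B i] from being much smaller than the [A i]. *)
have mB : m <= (\prod_i #|B i|%:R) `^ g.
  have := energy_le R B0; rewrite NBE -[leRHS]mul1r ler_pM2r//.
  by rewrite ler_pdivrMr// mul1r.
(* Passing to subsets only lowers the product of sizes, so [mA'] still yields normalised energy at
   least [k]. *)
have NB : k * (\prod_i #|B i|%:R) `^ (3 / 4) <= #|additive_quadruples B|%:R.
  rewrite NBE ler_pM2r// ler_pdivlMr//; apply: le_trans mA'.
  rewrite ler_pM2l// ge0_ler_powR ?(ltW g0) ?nnegrE ?(ltW pA0) ?(ltW pB0)//.
  by apply: ler_prod => i _; rewrite ler0n ler_nat subset_leq_card.
have [H [x [Hx Hk]]] := coherent_structure B0 k01 coh NB.
have BAc i : 0 < (#|B i|%:R : R) <= #|A i|%:R.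
  by rewrite cB0 ler_nat subset_leq_card.
have size := extremal_size g0 k0 BAc (le_trans mA' mB).
have gE : k `^ g^-1 = K `^ (- (150 * 150 * K)).
  rewrite {1}/k -(powR_inv1 (ltW K0)) -powRrM; congr (_ `^ _).
  by rewrite /g /k invf_div invrK mulN1r.
have cosetH i : #|A i :&: vcoset (x i) H|%:R <= #|H|%:R :> R.
  rewrite ler_nat (leq_trans (subset_leq_card (subsetIr _ _)))//.
  exact: leq_imset_card.
have BAx i : #|B i :&: vcoset (x i) H|%:R <= #|A i :&: vcoset (x i) H|%:R :> R.
  by rewrite ler_nat subset_leq_card// setSI.
exists H, x; split=> [i|].
  apply: le_trans (cosetH i); apply: le_trans (BAx i); apply: le_trans (Hx i).
  by rewrite -mulrA ler_wpM2l ?divr_ge0// -gE.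
have h0 : 0 <= #|H|%:R :> R by [].
(* The constant [1/2] of the conclusion leaves room, since [99/100 * 3/4 > 1/2]. *)
apply: (@le_trans _ _ (99 / 100 * (3 / 4 * k * #|H|%:R))).
  have -> : 1 / (2 * K) = k / 2 by rewrite /k invfM mul1r mulrC.
  by have := mulr_ge0 (ltW k0) h0; lra.
apply: (@le_trans _ _ (99 / 100 * (\prod_i #|B i|%:R) `^ (1 / 4))).
  by rewrite ler_wpM2l ?divr_ge0.
have -> : 99 / 100 * (\prod_i #|B i|%:R) `^ (1 / 4)
    = \prod_i (99 / 100 * #|B i|%:R) `^ (1 / 4) :> R.
  rewrite -[in RHS]powR_prod4 => [|i]; last by rewrite mulr_ge0 ?divr_ge0.
  rewrite big_split /= prodr_const card_ord powRM ?exprn_ge0 ?divr_ge0 ?(ltW pB0)//.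
  congr (_ * _); rewrite -powR_mulrn ?divr_ge0// -powRrM mul1r divff ?pnatr_eq0//.
  by rewrite powRr1 ?divr_ge0.
apply: ler_prod => i _; rewrite powR_ge0 /=.
apply: ge0_ler_powR; rewrite ?nnegrE ?divr_ge0//; first by rewrite mulr_ge0 ?divr_ge0.
exact: le_trans (Hx i) (BAx i).
Qed.
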